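(* Let $k$ be any field. There exist two geometrically irreducible closed curves $C,D\subset\mathbb{A}^2$ which are not isomorphic, but whose complements $\mathbb{A}^2\setminus C$ and $\mathbb{A}^2\setminus D$ are isomorphic. Furthermore, $C$ and $D$ can be chosen of degree $7$ if $k$ has more than $2$ elements, and of degree $13$ if $k$ has $2$ elements.
   Context: All varieties and morphisms are over $k$. Geometrically irreducible means irreducible over an algebraic closure $\bar k$. *)

(* Defs.v *)
From HB Require Import structures.
From mathcomp Require Import all_boot all_order all_algebra.
From mathcomp Require Import fraction.
From mathcomp.multinomials Require Import mpoly.

Set Implicit Arguments.
Unset Strict Implicit.
Unset Printing Implicit Defensive.
Import Order.TTheory GRing.Theory.
Local Open Scope ring_scope.

(* Plane curves over a field F are given by bivariate polynomials in
   {mpoly F[2]} (variables 'X_0 = x, 'X_1 = y).  A closed irreducible curve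
   C in A^2 is C = V(f) with f irreducible in F[x,y]; its coordinate ring is
   F[x,y]/(f), and the complement A^2 \ C = D(f) is affine with coordinate
   ring F[x,y][1/f], seen inside the fraction field F(x,y). *)

Section PlaneCurves.
Variable F : fieldType.

Local Notation P := {mpoly F[2]}.
Local Notation K := {fraction P}.
Local Notation "x %:F" := (@FracField.tofrac P x).

Definition irreducible_elt (R : idomainType) (p : R) : Prop :=
  p != 0 /\ ~~ (p \is a GRing.unit) /\
  forall a b : R, p = a * b -> a \is a GRing.unit \/ b \is a GRing.unit.

Definition tdeg (p : P) : nat := (msize p).-1.

Definition mdvd (a b : P) : Prop := exists h : P, b = h * a.

Definition evP (phi : 'I_2 -> P) (p : P) : P := mmap (fun c : F => c%:MP) phi p.

(* Isomorphism of the affine curves V(f) and V(g), i.e. of F-algebras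
   F[x,y]/(f) ~ F[x,y]/(g): phi : F[x,y]/(g) -> F[x,y]/(f) is given by the
   images phi_i of the coordinates (well defined iff g(phi) in (f)), psi
   likewise, and the two composites are the identity on the coordinates. *)
Definition curve_iso (f g : P) : Prop :=
  exists phi psi : 'I_2 -> P,
    [/\ mdvd f (evP phi g), mdvd g (evP psi f),
        (forall i, mdvd f (evP phi (psi i) - 'X_i)) &
        (forall i, mdvd g (evP psi (phi i) - 'X_i))].

Definition evK (u : 'I_2 -> K) (p : P) : K := mmap (fun c : F => (c%:MP)%:F) u p.

Definition in_loc (f : P) (z : K) : Prop :=
  exists (a : P) (n : nat), z = a%:F / (f%:F) ^+ n.

Definition unit_loc (f : P) (z : K) : Prop :=
  z != 0 /\ in_loc f z /\ in_loc f z^-1.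

(* Isomorphism of the complements A^2 \ V(f) and A^2 \ V(g), i.e. of the
   F-algebras F[x,y][1/f] ~ F[x,y][1/g].  An F-algebra morphism
   F[x,y][1/f] -> F[x,y][1/g] is determined by the images u_i = a_i/g^m of
   the coordinates, subject to f(u) being a unit of F[x,y][1/g]; it maps
   b/f^n to b(u)/f(u)^n.  Similarly v_i = b_i/f^n for the inverse, and the
   composites are required to fix the coordinates. *)
Definition compl_iso (f g : P) : Prop :=
  exists (a b : 'I_2 -> P) (m n : nat),
    let u := fun i => (a i)%:F / (g%:F) ^+ m in
    let v := fun i => (b i)%:F / (f%:F) ^+ n in
    [/\ unit_loc g (evK u f), unit_loc f (evK v g),
        (forall i, evK u (b i) / (evK u f) ^+ n = ('X_i : P)%:F) &
        (forall i, evK v (a i) / (evK v g) ^+ m = ('X_i : P)%:F)].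

Definition zeroset (L : closedFieldType) (S : {mpoly L[2]} -> Prop)
  (v : 'I_2 -> L) : Prop := forall p, S p -> p.@[v] = 0.

Definition irreducible_subspace (L : closedFieldType)
  (Z : ('I_2 -> L) -> Prop) : Prop :=
  (exists v, Z v) /\
  forall S1 S2 : {mpoly L[2]} -> Prop,
    (forall v, Z v -> zeroset S1 v \/ zeroset S2 v) ->
    (forall v, Z v -> zeroset S1 v) \/ (forall v, Z v -> zeroset S2 v).

Definition is_alg_closure (L : closedFieldType) (s : {rmorphism F -> L}) : Prop :=
  forall z : L, exists q : {poly F}, q != 0 /\ root (map_poly s q) z.

Definition geom_irreducible (f : P) : Prop :=
  forall (L : closedFieldType) (s : {rmorphism F -> L}),
    is_alg_closure s ->
    irreducible_subspace (zeroset (fun p => p = map_mpoly s f)).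

Definition two_elements : Prop := forall x : F, x = 0 \/ x = 1.

End PlaneCurves.

(* Main.v *)
(* Let [P = c T^(k+2) + b T^(k+1) + a T + e] with [c, e <> 0], and let
   [H = (x^(k+1) y - a x + 1) / e], [f = c x + b H + y H^(k+1)].  The curve [f = 0]
   is parametrized by [x = t / P(t)], [y = - (b + c t) P(t)^k], with [H = 1 / P(t)],
   so its coordinate ring is [F[t, 1/P]].  The map [(H / f, - y f^k)] sends the
   complement of this curve isomorphically onto that of the analogous curve for
   the reciprocal polynomial [P*].  The degree is [(k+1)(k+2) + 1], that is 7
   for cubic and 13 for quartic [P].

   An isomorphism [F[t, 1/P*] -> F[t, 1/P]] is given by a Moebius map carrying
   the roots of [P] together with infinity to those of [P*] with infinity.
   For cubics this is excluded by the degree-two invariant of binary quartics,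
   which is chosen to vanish for one of the two quadruples only; over the field
   with two elements, by [P = T^4 + T^3 + 1], whose roots are not moved to those
   of [T^4 + T + 1] by an affine substitution. *)

Require Import Defs.
From Stdlib Require Import Classical.
From HB Require Import structures.
From mathcomp Require Import all_boot all_order all_algebra.
From mathcomp Require Import fraction ring zify separable.
From mathcomp.multinomials Require Import mpoly.

Set Implicit Arguments.
Unset Strict Implicit.
Unset Printing Implicit Defensive.
Import GRing.Theory.
Local Open Scope ring_scope.

(** * Rational functions of degree one *)

Section Homogenization.
Variable F : fieldType.
Implicit Types E A N : {poly F}.

(** The coefficients form a function into [R], so that one formula serves over [F], over [F[T]] and
    over function fields; [m] is a formal degree, possibly larger than the true one. *)
Definition homogenize (R : comNzRingType) (m : nat) (q : nat -> R) (u v : R) : R :=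
  \sum_(i < m.+1) q i * u ^+ i * v ^+ (m - i).

Lemma homogE (R : fieldType) (h : {rmorphism F -> R}) m E (u v : R) :
  (size E <= m.+1)%N -> v != 0 ->
  homogenize m (fun i => h E`_i) u v = v ^+ m * (map_poly h E).[u / v].
Proof.
move=> sE v0; rewrite (@horner_coef_wide _ m.+1) ?size_map_poly // mulr_sumr.
apply: eq_bigr => i _; rewrite coef_map exprMn exprVn.
have -> : v ^+ m = v ^+ (m - i) * v ^+ i by rewrite -exprD subnK // -ltnS.
by field; rewrite expf_neq0.
Qed.

Lemma homog0 (R : comNzRingType) m (q : nat -> R) (u : R) :
  homogenize m q u 0 = q m * u ^+ m.
Proof.
rewrite /homogenize big_ord_recr /= subnn expr0 mulr1 big1 ?add0r // => i _.
by rewrite expr0n subn_eq0 leqNgt ltn_ord mulr0.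
Qed.

(** Every term but the one in [A ^+ m] contains a factor [N]. *)
Lemma homog_modp m E A N :
  N %| homogenize m (fun i => (E`_i)%:P) A N - (E`_m)%:P * A ^+ m.
Proof.
rewrite /homogenize big_ord_recr /= subnn expr0 mulr1 addrK.
elim/big_ind: _ => [|p q|i _]; [exact: dvdp0|exact: dvdp_add|].
by rewrite -[(m - i)%N]prednK ?subn_gt0 // exprS mulrCA dvdp_mulr.
Qed.

Lemma coefM_top (p q : {poly F}) i j :
  (size p <= i.+1)%N -> (size q <= j.+1)%N -> (p * q)`_(i + j) = p`_i * q`_j.
Proof.
move=> sp sq; rewrite coefM (bigD1 (inord i)) //= inordK ?addKn; last by lia.
rewrite big1 ?addr0 // => -[l ll] /=; rewrite -val_eqE /= inordK; last by lia.
move=> li; case: (ltngtP l i) => // lt_li; last by move/eqP: li.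
  by rewrite [q`__]nth_default ?mulr0 // (leq_trans sq) //; lia.
by rewrite nth_default ?mul0r // (leq_trans sp) //; lia.
Qed.

Lemma coefX_top (p : {poly F}) i n :
  (size p <= i.+1)%N -> (size (p ^+ n) <= (i * n).+1)%N /\ (p ^+ n)`_(i * n) = p`_i ^+ n.
Proof.
move=> sp; elim: n => [|n [sn IHn]].
  by rewrite muln0 !expr0 size_poly1 coef1.
rewrite mulnS !exprS coefM_top // IHn; split=> //.
by apply: leq_trans (size_polyMleq _ _) _; lia.
Qed.

(** Each term is a product of [m] factors of formal degree [n], so its coefficient of degree [n * m]
    is the product of the formal leading coefficients. *)
Lemma coef_homog m n E A N : (size A <= n.+1)%N -> (size N <= n.+1)%N ->
  (homogenize m (fun i => (E`_i)%:P) A N)`_(n * m) =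
  homogenize m (fun i => E`_i) A`_n N`_n.
Proof.
move=> sA sN; rewrite /homogenize coef_sum; apply: eq_bigr => i _.
have -> : (n * m = n * i + n * (m - i))%N by rewrite -mulnDr subnKC // -ltnS.
have [sAi cAi] := coefX_top i sA.
have [sNi cNi] := coefX_top (m - i) sN.
by rewrite -mulrA coefCM coefM_top // cAi cNi mulrA.
Qed.

(** Two coprime forms have no common projective zero: for [v = 0] a nonzero top coefficient forces
    [u = 0], and otherwise [u / v] would be a common root. *)
Lemma homog_coprime m E B (u v : F) : coprimep E B ->
  (size E <= m.+1)%N -> (size B <= m.+1)%N -> (E`_m != 0) || (B`_m != 0) ->
  homogenize m (fun i => E`_i) u v = 0 -> homogenize m (fun i => B`_i) u v = 0 ->
  u = 0 /\ v = 0.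
Proof.
move=> cEB sE sB nz hE hB; have [v0|v0] := eqVneq v 0.
  move: hE hB; rewrite v0 !homog0 => /eqP; rewrite mulf_eq0 => hE /eqP.
  rewrite mulf_eq0 => hB; split=> //; apply/eqP; move: hE hB; rewrite !expf_eq0.
  by case/orP: nz => /negPf-> /=; [move=> /andP[_ ->]|move=> _ /andP[_ ->]].
have hor (G : {poly F}) : (size G <= m.+1)%N -> homogenize m (fun i => G`_i) u v = 0 -> root G (u / v).
  move=> sG; rewrite (@homogE _ idfun) // map_poly_id // => /eqP.
  by rewrite mulf_eq0 expf_eq0 (negPf v0) andbF.
have /(coprimep_root cEB) := hor E sE hE.
by rewrite -rootE hor.
Qed.

End Homogenization.

Definition rat_const (F : fieldType) : {rmorphism F -> {fraction {poly F}}} :=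
  (@FracField.tofrac {poly F}) \o polyC.

Section Moebius.
Variable F : fieldType.
Local Notation K := {fraction {poly F}}.
Local Notation "x %:F" := (@FracField.tofrac {poly F} x).
Local Notation homp m E A N := (homogenize m (fun i => (E`_i)%:P) A N).

Lemma tofrac_inj : injective (@FracField.tofrac {poly F}).
Proof. by move=> p q /eqP; rewrite tofrac_eq => /eqP. Qed.

Lemma tofrac_homog m (E A N : {poly F}) (s : K) :
  (size E <= m.+1)%N -> N != 0 -> s = A%:F / N%:F ->
  (homp m E A N)%:F = N%:F ^+ m * (map_poly (rat_const F) E).[s].
Proof.
move=> sE N0 ->; rewrite -homogE ?tofrac_eq0 // /homogenize rmorph_sum.
by apply: eq_bigr => i _; rewrite !rmorphM !rmorphXn.
Qed.

Lemma coprimep_fracP (s : K) (A0 N0 : {poly F}) : N0 != 0 -> s = A0%:F / N0%:F ->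
  exists A N, [/\ N != 0, coprimep A N & s = A%:F / N%:F].
Proof.
move=> N00 ->; pose g := gcdp A0 N0.
have g0 : g != 0 by rewrite gcdp_eq0 (negPf N00) andbF.
have N0E : N0 = N0 %/ g * g by rewrite divpK // dvdp_gcdr.
have A0E : A0 = A0 %/ g * g by rewrite divpK // dvdp_gcdl.
exists (A0 %/ g), (N0 %/ g); have Ng0 : N0 %/ g != 0.
  by apply: contra_neq N00 => Ng0; rewrite N0E Ng0 mul0r.
split=> //; first by rewrite coprimep_div_gcd // N00 orbT.
by rewrite {1}A0E {1}N0E !tofracM -mulf_div divff ?mulr1 // tofrac_eq0.
Qed.

(* Multiplicativity of the degree of rational functions: if [X = (B/E)(s)] in
   lowest terms with [m] the degree of [B/E] and [n] that of [s], comparing the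
   coefficients of degree [n m] in the homogenized equation gives [n m <= 1]. *)
Lemma moebius (s : K) (A0 N0 E0 B0 : {poly F}) : N0 != 0 -> s = A0%:F / N0%:F ->
  (map_poly (rat_const F) E0).[s] != 0 ->
  'X%:F * (map_poly (rat_const F) E0).[s] = (map_poly (rat_const F) B0).[s] ->
  exists al be ga de : F, al * de - be * ga != 0 /\
    s = (al *: 'X + be%:P)%:F / (ga *: 'X + de%:P)%:F.
Proof.
move=> N00 s0 Es0 XE; have [A [N [N_n0 cAN sE]]] := coprimep_fracP N00 s0.
have Nf0 : N%:F != 0 by rewrite tofrac_eq0.
pose g := gcdp E0 B0; pose E := E0 %/ g; pose B := B0 %/ g.
have E0E : E0 = E * g by rewrite divpK // dvdp_gcdl.
have B0E : B0 = B * g by rewrite divpK // dvdp_gcdr.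
have E0n0 : E0 != 0 by apply: contra_neq Es0 => ->; rewrite rmorph0 horner0.
have cEB : coprimep E B by rewrite coprimep_div_gcd // E0n0.
move: Es0 XE; rewrite {}E0E {}B0E !rmorphM !hornerM mulf_eq0 negb_or.
move=> /andP[Es0 gs0]; rewrite mulrA => /(mulIf gs0) XE.
pose m := (maxn (size E) (size B)).-1.
have En0 : E != 0 by apply: contra_neq Es0 => ->; rewrite rmorph0 horner0.
have szE : (0 < size E)%N by rewrite size_poly_gt0.
have sEm : (size E <= m.+1)%N by rewrite /m prednK ?leq_maxl // leq_max szE.
have sBm : (size B <= m.+1)%N by rewrite /m prednK ?leq_maxr // leq_max szE.
have topEB : (E`_m != 0) || (B`_m != 0).
  rewrite /m; case: (leqP (size B) (size E)) => [le_BE|lt_EB].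
    by rewrite -lead_coefE lead_coef_eq0 En0.
  by rewrite -[_.-1]/(_.-1) -lead_coefE lead_coef_eq0 -size_poly_gt0 (leq_ltn_trans _ lt_EB) ?orbT.
pose Eh := homp m E A N; pose Bh := homp m B A N.
have Ehs : Eh%:F = N%:F ^+ m * (map_poly (rat_const F) E).[s] by apply: tofrac_homog.
have Bhs : Bh%:F = N%:F ^+ m * (map_poly (rat_const F) B).[s] by apply: tofrac_homog.
have Eh0 : Eh != 0.
  have := mulf_neq0 (expf_neq0 m Nf0) Es0.
  by rewrite -Ehs tofrac_eq0.
have XEh : 'X * Eh = Bh.
  by apply: tofrac_inj; rewrite tofracM Ehs Bhs -XE mulrCA.
have cEhN : coprimep Eh N.
  apply/coprimepP => d dE dN.
  have dB : d %| Bh by rewrite -XEh dvdp_mull.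
  have aux (G : {poly F}) : d %| homp m G A N -> G`_m != 0 -> d %| A ^+ m.
    move=> dG Gm; have := dvdp_sub dG (dvdp_trans dN (homog_modp m G A N)).
    by rewrite opprB addrC subrK mul_polyC dvdpZr.
  have dA : d %| A ^+ m by case/orP: topEB; [apply: aux dE|apply: aux dB].
  have := coprimep_expl m cAN; rewrite coprimep_sym => /coprimepP; exact.
(* Homogenizing a Bezout relation between [E] and [B] writes a power of [N] as a combination of [Eh]
   and [Bh = 'X * Eh]. As [Eh] is coprime to [N], it is then a nonzero constant, and [Bh] has degree
   one. *)
have [[U V] /= UV] := Bezout_eq1_coprimepP _ _ cEB.
pose n' := maxn (size U) (size V).
have EhN : Eh %| N ^+ (n' + m).
  have -> : N ^+ (n' + m) = homp n' U A N * Eh + homp n' V A N * Bh.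
    apply: tofrac_inj; rewrite tofracD !tofracM tofracXn Ehs Bhs.
    rewrite !(@tofrac_homog n' _ A N s) // ?leqW ?leq_maxl ?leq_maxr //.
    have := congr1 (fun p => (map_poly (rat_const F) p).[s]) UV.
    rewrite rmorphD !rmorphM rmorph1 hornerD !hornerM hornerC => UVs.
    rewrite exprD -[LHS]mulr1 -UVs mulrDr.
    by congr (_ + _); apply: mulrACA.
  by rewrite -XEh mulrCA mulrA -mulrDl dvdp_mull.
have sEh : size Eh = 1%N.
  apply/eqP; rewrite -coprimepp; apply: coprimep_dvdl EhN _.
  by rewrite coprimep_expr.
have sBh : size Bh = 2%N by rewrite -XEh mulrC size_mulX // sEh.
pose n := (maxn (size A) (size N)).-1.
have szN : (0 < size N)%N by rewrite size_poly_gt0.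
have sAn : (size A <= n.+1)%N by rewrite /n prednK ?leq_maxl // leq_max szN orbT.
have sNn : (size N <= n.+1)%N by rewrite /n prednK ?leq_maxr // leq_max szN orbT.
have n1 : (n <= 1)%N.
  rewrite leqNgt; apply/negP => n_gt1.
  have m_gt0 : (0 < m)%N.
    rewrite lt0n; apply/eqP => m0; move: sBh; rewrite /Bh m0 /homogenize big_ord1.
    rewrite !expr0 !mulr1 => sB0.
    by have := size_polyC_leq1 (B`_0); rewrite sB0.
  have nm : (1 < n * m)%N by apply: leq_trans n_gt1 _; rewrite leq_pmulr.
  (* Degree [n * m] exceeds the degrees 0 of [Eh] and 1 of [Bh], so both forms vanish at the pair of
     top coefficients of [A] and [N], which by the choice of [n] is not zero. *)
  have hE0 : homogenize m (fun i => E`_i) A`_n N`_n = 0.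
    by rewrite -coef_homog // nth_default // -/Eh sEh ltnW.
  have hB0 : homogenize m (fun i => B`_i) A`_n N`_n = 0.
    by rewrite -coef_homog // nth_default // -/Bh sBh.
  have [An0 Nn0] := homog_coprime cEB sEm sBm topEB hE0 hB0.
  move: An0 Nn0; rewrite /n; case: (leqP (size N) (size A)) => [le|lt] An0 Nn0.
    move/eqP: An0; rewrite -lead_coefE lead_coef_eq0 -size_poly_eq0 => /eqP A0s.
    by move: le; rewrite A0s leqNgt szN.
  by move/eqP: Nn0; rewrite -lead_coefE lead_coef_eq0 (negPf N_n0).
have lin (G : {poly F}) : (size G <= n.+1)%N -> G = G`_1 *: 'X + (G`_0)%:P.
  move=> sG; apply/polyP => -[|[|i]]; rewrite !coefE /= ?mulr0 ?mulr1 ?add0r ?addr0 //.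
  by rewrite nth_default // (leq_trans sG) // ltnS (leq_trans n1).
(* A zero determinant makes [A] and [N] proportional, hence both constant, against the degree one of
   [Bh]. *)
exists A`_1, A`_0, N`_1, N`_0; split; last by rewrite -!lin.
apply/eqP => det0.
have N1A : N`_1 *: A = A`_1 *: N.
  rewrite [in LHS](lin A) // [in RHS](lin N) // !scalerDr !scalerA mulrC.
  congr (_ + _); rewrite -!mul_polyC -!polyCM; congr (_%:P).
  by rewrite (subr0_eq det0) mulrC.
have [N10|N10] := eqVneq N`_1 0.
  move/eqP: N1A; rewrite N10 scale0r eq_sym scaler_eq0 (negPf N_n0) orbF => /eqP A10.
  have sA1 : A = (A`_0)%:P by rewrite {1}(lin A) // A10 scale0r add0r.
  have sN1 : N = (N`_0)%:P by rewrite {1}(lin N) // N10 scale0r add0r.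
  suff : (size Bh <= 1)%N by rewrite sBh.
  rewrite /Bh sA1 sN1 /homogenize.
  rewrite (_ : \sum_(i < _) _ = (homogenize m (fun i => B`_i) A`_0 N`_0)%:P) ?size_polyC_leq1 //.
  rewrite /homogenize rmorph_sum; apply: eq_bigr => i _.
  by rewrite !rmorphM !rmorphXn.
have NA : N %| A by rewrite -(dvdpZr _ _ N10) N1A -mul_polyC dvdp_mull.
have sN : size N = 1%N.
  by apply/eqP; rewrite -coprimepp; apply: coprimep_dvdl NA _; rewrite coprimep_sym.
by move/eqP: N10; apply; rewrite nth_default ?sN.
Qed.
End Moebius.

(** * The curves and their parametrization *)

Section Divisibility.
Variable F : fieldType.
Implicit Types d p q : {mpoly F[2]}.

Lemma mdvdM d p q : mdvd d p -> mdvd d (q * p).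
Proof. by move=> [h ->]; exists (q * h); rewrite mulrA. Qed.

Lemma mdvdD d p q : mdvd d p -> mdvd d q -> mdvd d (p + q).
Proof. by move=> [h ->] [h' ->]; exists (h + h'); rewrite mulrDl. Qed.

Lemma mdvd_subXX d p q n : mdvd d (p - q) -> mdvd d (p ^+ n - q ^+ n).
Proof. by move=> dpq; rewrite subrXX mulrC; apply: mdvdM. Qed.

End Divisibility.

Lemma ord2_cases (i : 'I_2) : i = ord0 \/ i = ord_max.
Proof. by case: i => [[|[|//]]] lt_i; [left|right]; apply: val_inj. Qed.

Lemma mmap_horner (F : fieldType) (R : comNzRingType) (h : {rmorphism F -> R})
    (v : 'I_2 -> R) (r : {poly F}) (p : {mpoly F[2]}) :
  mmap h v (map_poly (@mpolyC 2 _) r).[p] = (map_poly h r).[mmap h v p].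
Proof.
rewrite -horner_map -map_poly_comp; congr (_.[_]).
by apply: eq_map_poly => c /=; rewrite mmapC.
Qed.

Lemma mmap_mpolyC (F : fieldType) (R : comNzRingType) (h : {rmorphism F -> R})
    (v : 'I_2 -> R) (c : F) : mmap h v c%:MP = h c.
Proof. exact: mmapC. Qed.

Lemma rmorph_mmap (F : fieldType) (R R' : comNzRingType) (g : {rmorphism R -> R'})
    (h : {rmorphism F -> R}) (v : 'I_2 -> R) (p : {mpoly F[2]}) :
  g (mmap h v p) = mmap (g \o h) (g \o v) p.
Proof.
rewrite /mmap rmorph_sum; apply: eq_bigr => m _; rewrite rmorphM /=.
by congr (_ * _); rewrite /mmap1 rmorph_prod; apply: eq_bigr => i _; rewrite rmorphXn.
Qed.

Lemma mmap_id (F : fieldType) (p : {mpoly F[2]}) :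
  mmap (@mpolyC 2 F) (fun i => 'X_i) p = p.
Proof.
rewrite [RHS]mpolyE /mmap; apply: eq_bigr => m _.
by rewrite mmap1_id mul_mpolyC.
Qed.

Section Curve.
Variables (F : fieldType) (k : nat).
Local Notation P := {mpoly F[2]}.
Local Notation X := ('X_ord0 : P).
Local Notation Y := ('X_ord_max : P).

Definition curveP (c b a e : F) : {poly F} :=
  c *: 'X^(k.+2) + b *: 'X^(k.+1) + a *: 'X + e%:P.

Definition curveH (a e : F) : P :=
  (e^-1)%:MP * (X ^+ k.+1 * Y - a%:MP * X + 1).

Definition curve (c b a e : F) : P :=
  c%:MP * X + b%:MP * curveH a e + Y * curveH a e ^+ k.+1.

(** The inverse of the parametrization: on the curve [y H^k = - (b + c t)], and solving for [t]
    gives this polynomial. *)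
Definition curveS (c b a e : F) : P :=
  - (c^-1)%:MP * (b%:MP + Y * curveH a e ^+ k).

Section Eval.
Variables (R : fieldType) (h : {rmorphism F -> R}) (v : 'I_2 -> R) (c b a e : F).
Local Notation ev := (mmap h v).
Local Notation H := (curveH a e).

Lemma mmap_X i : ev 'X_i = v i.
Proof. by rewrite mmapX mmap1U. Qed.

Lemma mmap_curveH :
  ev H = (v ord0 ^+ k.+1 * v ord_max - h a * v ord0 + 1) / h e.
Proof.
rewrite mulrC rmorphM rmorphD rmorphB rmorphM rmorphM rmorphXn rmorph1 /=.
by rewrite !mmap_mpolyC !mmap_X fmorphV.
Qed.

Lemma mmap_curve :
  ev (curve c b a e) = h c * v ord0 + h b * ev H + v ord_max * ev H ^+ k.+1.
Proof.
rewrite /curve; move: H => q.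
by rewrite !rmorphD !rmorphM rmorphXn /= !mmap_mpolyC !mmap_X.
Qed.

Lemma mmap_curveS :
  ev (curveS c b a e) = - (h b + v ord_max * ev H ^+ k) / h c.
Proof.
rewrite /curveS mulNr -mulrN mulrC; move: H => q.
by rewrite rmorphM rmorphN rmorphD rmorphM rmorphXn /= !mmap_mpolyC mmap_X fmorphV.
Qed.

End Eval.
End Curve.

Section Param.
Variables (F : fieldType) (k : nat) (c b a e : F).
Hypotheses (c0 : c != 0) (e0 : e != 0).
Local Notation P := {mpoly F[2]}.
Local Notation X := ('X_ord0 : P).
Local Notation Y := ('X_ord_max : P).
Local Notation Pc := (curveP k c b a e).
Local Notation H := (curveH k a e).
Local Notation f := (curve k c b a e).
Local Notation S := (curveS k c b a e).
Local Notation PS r := (map_poly (@mpolyC 2 _) r).[S].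

Lemma horner_curveP (R : comNzRingType) (h : {rmorphism F -> R}) (t : R) :
  (map_poly h Pc).[t] = t ^+ k.+1 * (h c * t + h b) + h a * t + h e.
Proof.
rewrite /curveP !rmorphD /= !map_polyZ !map_polyXn map_polyX map_polyC.
by rewrite !hornerD !hornerZ !hornerXn hornerX hornerC !exprS; ring.
Qed.

Lemma mulMPV : c%:MP * (c^-1)%:MP = 1 :> P.
Proof. by rewrite -mpolyCM divff. Qed.

Lemma curve_SH : S * H - X = - (c^-1)%:MP * f.
Proof.
rewrite /S /f exprS.
transitivity (- (c^-1)%:MP * (b%:MP * H + Y * (H * H ^+ k)) -
   (c%:MP * (c^-1)%:MP) * X :> P); last by ring.
by rewrite mulMPV; ring.
Qed.

Lemma curve_cS : c%:MP * S + b%:MP = - (Y * H ^+ k).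
Proof.
rewrite /S; transitivity (- (c%:MP * (c^-1)%:MP) * (b%:MP + Y * H ^+ k) + b%:MP).
  by ring.
by rewrite mulMPV; ring.
Qed.

Lemma mdvd_SH : mdvd f (S * H - X).
Proof. by rewrite curve_SH; exists (- (c^-1)%:MP). Qed.

(** Replacing [S H] by [x] and [c S + b] by [- y H^k] turns [H P(S)] into [- x^(k+1) y + a x + e H],
    which is 1 by the definition of [H]. *)
Lemma mdvd_HPS : mdvd f (H * PS Pc - 1).
Proof.
have eH : e%:MP * H = X ^+ k.+1 * Y - a%:MP * X + 1.
  by rewrite /H mulrA -mpolyCM divff // mul1r.
rewrite horner_curveP curve_cS.
have -> : H * (S ^+ k.+1 * - (Y * H ^+ k) + a%:MP * S + e%:MP) - 1 =
  - Y * ((S * H) ^+ k.+1 - X ^+ k.+1) + a%:MP * (S * H - X).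
  rewrite [H * _]mulrDr [H * e%:MP]mulrC eH [(S * H) ^+ _]exprMn [H ^+ k.+1]exprS; ring.
by apply: mdvdD; apply: mdvdM; first apply: mdvd_subXX; apply: mdvd_SH.
Qed.

(* The substitution [x = S H], [y = - (b + c S) P(S)^k] and [H P(S) = 1] modulo
   [f] is what makes [F[x,y]/(f)] isomorphic to [F[t, 1/P(t)]]. *)
Lemma curve_normal_form (p : P) :
  exists j r, mdvd f (p - H ^+ j * PS r).
Proof.
have HP1 n : mdvd f ((H * PS Pc) ^+ n - 1).
  by rewrite -(expr1n _ n); apply: mdvd_subXX; apply: mdvd_HPS.
pose N q := exists j r, mdvd f (q - H ^+ j * PS r).
have NC d : N d%:MP.
  by exists 0%N, d%:P; rewrite map_polyC hornerC mul1r subrr; exists 0; rewrite mul0r.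
have NM q1 q2 : N q1 -> N q2 -> N (q1 * q2).
  move=> [j1 [r1 d1]] [j2 [r2 d2]]; exists (j1 + j2)%N, (r1 * r2).
  rewrite rmorphM hornerM exprD.
  have -> : q1 * q2 - H ^+ j1 * H ^+ j2 * (PS r1 * PS r2) =
     q2 * (q1 - H ^+ j1 * PS r1) + H ^+ j1 * PS r1 * (q2 - H ^+ j2 * PS r2).
    by ring.
  by apply: mdvdD; apply: mdvdM.
have ND q1 q2 : N q1 -> N q2 -> N (q1 + q2).
  move=> [j1 [r1 d1]] [j2 [r2 d2]].
  (* Common denominator: each summand is multiplied by a power of [H P(S)], which is 1 modulo
     [f]. *)
  exists (j1 + j2)%N, (r1 * Pc ^+ j2 + r2 * Pc ^+ j1).
  rewrite rmorphD !rmorphM !rmorphXn hornerD !hornerM !horner_exp exprD.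
  have -> : q1 + q2 - H ^+ j1 * H ^+ j2 * (PS r1 * PS Pc ^+ j2 + PS r2 * PS Pc ^+ j1) =
     (q1 - H ^+ j1 * PS r1) + (q2 - H ^+ j2 * PS r2)
     + (- H ^+ j1 * PS r1 * ((H * PS Pc) ^+ j2 - 1)
        + - H ^+ j2 * PS r2 * ((H * PS Pc) ^+ j1 - 1)).
    by rewrite !exprMn; ring.
  by apply: mdvdD; apply: mdvdD => //; apply: mdvdM.
have NX : N X.
  exists 1%N, 'X; rewrite map_polyX hornerX expr1.
  have -> : X - H * S = - 1 * (S * H - X) by ring.
  by apply: mdvdM; apply: mdvd_SH.
have NY : N Y.
  exists 0%N, (- (c *: 'X + b%:P) * Pc ^+ k).
  rewrite expr0 mul1r rmorphM rmorphN rmorphD rmorphXn /= map_polyZ map_polyX.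
  rewrite map_polyC hornerM hornerN hornerD hornerZ hornerX hornerC horner_exp curve_cS.
  have -> : Y - - - (Y * H ^+ k) * PS Pc ^+ k = - Y * ((H * PS Pc) ^+ k - 1).
    by rewrite [(H * _) ^+ k]exprMn; ring.
  exact: mdvdM.
have NXn q n : N q -> N (q ^+ n).
  move=> Nq; elim: n => [|n IHn]; first by rewrite expr0 -mpolyC1; apply: NC.
  by rewrite exprS; apply: NM.
rewrite -/(N p) [p]mpolyE; elim/big_ind: _ => // [|m _].
  by rewrite -mpolyC0; apply: NC.
rewrite -mul_mpolyC mpolyXE_id; apply: (NM) => //.
elim/big_ind: _ => [|q1 q2|i _]; [by rewrite -mpolyC1; apply: NC|exact: NM|].
by apply: NXn; case: (ord2_cases i) => ->.
Qed.

Section Points.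
Variables (R : fieldType) (h : {rmorphism F -> R}).
Local Notation ev := (mmap h).
Local Notation PR := (map_poly h Pc).

Lemma mdvd_eq0 (v : 'I_2 -> R) (d p : P) : mdvd d p -> ev v d = 0 -> ev v p = 0.
Proof. by move=> [q ->] d0; rewrite rmorphM /= d0 mulr0. Qed.

Lemma mdvd_eval (v : 'I_2 -> R) (d p q : P) :
  mdvd d (p - q) -> ev v d = 0 -> ev v p = ev v q.
Proof. by move=> dpq d0; apply/eqP; rewrite -subr_eq0 -rmorphB; apply/eqP; apply: mdvd_eq0 dpq d0. Qed.

Definition curve_pt (t : R) (i : 'I_2) : R :=
  if i == ord0 then t / PR.[t] else - (h c * t + h b) * PR.[t] ^+ k.

Lemma eval_curve_pt t : PR.[t] != 0 ->
  [/\ ev (curve_pt t) f = 0, ev (curve_pt t) H = PR.[t]^-1 &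
      ev (curve_pt t) S = t].
Proof.
move=> P0; set v := curve_pt t.
have hc : h c != 0 by rewrite fmorph_eq0.
have he : h e != 0 by rewrite fmorph_eq0.
have vX : v ord0 = t / PR.[t] by [].
have vY : v ord_max = - (h c * t + h b) * PR.[t] ^+ k by [].
have vH : ev v H = PR.[t]^-1.
  rewrite mmap_curveH vX vY; apply: (mulIf he); rewrite mulfVK //.
  apply: (mulIf P0); rewrite mulrAC mulVf // mul1r.
  have -> : (t / PR.[t]) ^+ k.+1 * (- (h c * t + h b) * PR.[t] ^+ k) =
            - (t ^+ k.+1 * (h c * t + h b)) / PR.[t].
    by rewrite exprMn exprVn [PR.[t] ^+ k.+1]exprS; field; rewrite P0 expf_neq0.
  have -> : (- (t ^+ k.+1 * (h c * t + h b)) / PR.[t] - h a * (t / PR.[t]) + 1)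
              * PR.[t] = - (t ^+ k.+1 * (h c * t + h b)) - h a * t + PR.[t].
    by field.
  by rewrite horner_curveP; ring.
have vYH : v ord_max * ev v H ^+ k = - (h c * t + h b).
  by rewrite vY vH exprVn mulfK // expf_neq0.
split=> //.
  by rewrite mmap_curve [ev v H ^+ _]exprSr [v ord_max * (_ * _)]mulrA vYH vX vH; field.
by rewrite mmap_curveS vYH; field.
Qed.

(** Conversely to the parametrization, evaluating [H P(S) = 1] at a point shows that its parameter
    is no root of [P]. *)
Lemma curve_ptP (v : 'I_2 -> R) : ev v f = 0 ->
  PR.[ev v S] != 0 /\ ev v H = PR.[ev v S]^-1.
Proof.
move=> f0; have := mdvd_eval mdvd_HPS f0.
rewrite rmorphM rmorph1 /= mmap_horner => HP.
have P0 : PR.[ev v S] != 0.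
  by apply: contra_eq_neq HP => ->; rewrite mulr0 eq_sym oner_neq0.
by split=> //; apply: (mulIf P0); rewrite HP mulVf.
Qed.

Lemma eval_normal_form (p : P) :
  exists j r, forall v : 'I_2 -> R, ev v f = 0 ->
    ev v p * PR.[ev v S] ^+ j = (map_poly h r).[ev v S].
Proof.
have [j [r fp]] := curve_normal_form p; exists j, r => w f0.
have [P0 wH] := curve_ptP f0.
rewrite (mdvd_eval fp f0) rmorphM rmorphXn /= mmap_horner wH exprVn.
by rewrite mulrAC mulVf ?mul1r // expf_neq0.
Qed.

End Points.
End Param.

Lemma horner_rat_const (F : fieldType) (r : {poly F}) :
  (map_poly (rat_const F) r).[FracField.tofrac 'X] = FracField.tofrac r.
Proof. by rewrite map_poly_comp horner_map /= -/(comp_poly 'X r) comp_polyXr. Qed.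

(** * Irreducibility and degree of the curves *)

Section Irreducible.
Variables (F : fieldType) (k : nat) (c b a e : F).
Hypotheses (c0 : c != 0) (e0 : e != 0).
Local Notation P := {mpoly F[2]}.
Local Notation f := (curve k c b a e).
Local Notation Pc := (curveP k c b a e).

Lemma curveP_neq0 : Pc != 0.
Proof.
apply: contra_neq e0 => P0; have := horner_curveP k c b a e idfun 0.
by rewrite P0 rmorph0 horner0 exprS !(mul0r, mulr0, add0r) /= => <-.
Qed.

(** The parameter [T] in [F(T)] gives a generic point. A normal form [H^j r(S)] takes there the
    value [r / P^j], which vanishes only for [r = 0]. *)
Lemma mdvd_curve (p : P) :
  mmap (rat_const F) (curve_pt k c b a e (rat_const F) (FracField.tofrac 'X)) p = 0 ->
  mdvd f p.
Proof.
move=> p0; have [j [r fp]] := curve_normal_form k b a c0 e0 p.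
have P0 : (map_poly (rat_const F) Pc).[FracField.tofrac 'X] != 0.
  by rewrite horner_rat_const tofrac_eq0 curveP_neq0.
have [f0 vH vS] := eval_curve_pt c0 e0 P0.
move: (mdvd_eval fp f0); rewrite p0 rmorphM rmorphXn /= vH mmap_horner vS.
move/esym/eqP; rewrite mulf_eq0 expf_eq0 invr_eq0 (negPf P0) andbF /=.
rewrite horner_rat_const tofrac_eq0 => /eqP r0.
by move: fp; rewrite r0 rmorph0 horner0 mulr0 subr0.
Qed.

Lemma msizeDl (p q : P) : (msize q < msize p)%N -> msize (p + q) = msize p.
Proof.
move=> lt_qp; apply/eqP; rewrite eqn_leq; apply/andP; split.
  by apply: leq_trans (msizeD_le _ _) _; rewrite geq_max leqnn ltnW.
have := msizeD_le (p + q) (- q); rewrite addrK msizeN => /leq_trans; apply.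
rewrite geq_max leqnn /=; rewrite leqNgt; apply/negP => lt_pq.
have := msizeD_le (p + q) (- q); rewrite addrK msizeN leqNgt gtn_max lt_qp andbT.
by rewrite (ltn_trans lt_pq).
Qed.

Lemma msizeXn (p : P) d n : msize p = d.+1 -> msize (p ^+ n) = (d * n).+1.
Proof.
move=> sp; have p0 : p != 0 by rewrite -msize_poly_eq0 sp.
elim: n => [|n IHn]; first by rewrite muln0 expr0 msize1.
by rewrite exprS msizeM ?expf_neq0 // sp IHn mulnS; lia.
Qed.

Lemma msize_var (i : 'I_2) : msize ('X_i : P) = 2%N.
Proof. by rewrite msizeX mdeg1. Qed.

Lemma var_neq0 (i : 'I_2) : 'X_i != 0 :> P.
Proof. by rewrite -msize_poly_eq0 msize_var. Qed.

Lemma msize_constM (d : F) (p : P) : (msize (d%:MP * p) <= msize p)%N.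
Proof. by rewrite mul_mpolyC; apply: msizeZ_le. Qed.

Lemma msize_curveH : msize (curveH k a e) = k.+3.
Proof.
rewrite /curveH mul_mpolyC msizeZ ?invr_eq0 // -addrA.
have top : msize ('X_ord0 ^+ k.+1 * 'X_ord_max : P) = k.+3.
  rewrite msizeM ?expf_neq0 ?var_neq0 // (msizeXn _ (msize_var _)) msize_var; lia.
rewrite msizeDl top //; apply: leq_ltn_trans (msizeD_le _ _) _.
rewrite gtn_max msize1 andbT msizeN.
by apply: leq_ltn_trans (msize_constM _ _) _; rewrite msize_var.
Qed.

Lemma tdeg_curve : tdeg f = (k.+1 * k.+2).+1.
Proof.
have H0 : curveH k a e != 0 by rewrite -msize_poly_eq0 msize_curveH.
have top : msize ('X_ord_max * curveH k a e ^+ k.+1) = (k.+1 * k.+2).+2.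
  rewrite msizeM ?expf_neq0 ?var_neq0 // (msizeXn _ msize_curveH) msize_var.
  by rewrite [RHS]/= mulnC; lia.
rewrite /tdeg /curve addrC msizeDl top //; apply: leq_ltn_trans (msizeD_le _ _) _.
rewrite gtn_max; apply/andP; split; apply: leq_ltn_trans (msize_constM _ _) _.
  by rewrite msize_var.
by rewrite msize_curveH; nia.
Qed.

Lemma curve_neq0 : f != 0.
Proof. by apply: contra_eq_neq tdeg_curve => ->; rewrite /tdeg msize0. Qed.

(** If [f = p q], one factor vanishes at the generic point, since values there lie in a field. That
    factor is a multiple of [f], so the other is a unit. *)
Lemma irreducible_curve : irreducible_elt f.
Proof.
set v := curve_pt k c b a e (rat_const F) (FracField.tofrac 'X).
have P0 : (map_poly (rat_const F) Pc).[FracField.tofrac 'X] != 0.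
  by rewrite horner_rat_const tofrac_eq0 curveP_neq0.
have [f0 _ _] := eval_curve_pt c0 e0 P0.
split; first exact: curve_neq0; split.
  by apply/negP => /(rmorph_unit (mmap (rat_const F) v)); rewrite /= f0 unitr0.
have aux (p q : P) : f = p * q -> mmap (rat_const F) v p = 0 -> q \is a GRing.unit.
  move=> fpq /mdvd_curve [h ph]; apply/unitrP; exists h.
  suff hq1 : h * q = 1 by rewrite [q * h]mulrC.
  apply: (mulfI curve_neq0); rewrite mulr1 {2}fpq ph; ring.
move=> p q fpq; move: f0; rewrite {1}fpq rmorphM /= => /eqP.
rewrite mulf_eq0 => /orP[] /eqP pq0; [right; exact: aux fpq pq0|left].
by apply: aux pq0; rewrite mulrC.
Qed.

End Irreducible.

Lemma map_curve (F L : fieldType) (s : {rmorphism F -> L}) k (c b a e : F) :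
  map_mpoly s (curve k c b a e) = curve k (s c) (s b) (s a) (s e).
Proof.
have sH : map_mpoly s (curveH k a e) = curveH k (s a) (s e).
  rewrite /curveH rmorphM rmorphD rmorphB rmorphM rmorphM rmorphXn rmorph1 /=.
  by rewrite !map_mpolyC !map_mpolyX /= fmorphV.
move: sH; rewrite /curve; move: (curveH k a e) (curveH _ _ _) => q q' sq.
by rewrite !rmorphD !rmorphM rmorphXn /= !map_mpolyC !map_mpolyX sq.
Qed.

(** Base change only maps the coefficients. If neither closed set contains the curve, each has an
    equation that is, up to a power of [P], a nonzero polynomial [r1] or [r2] in the parameter; a
    value of [t] avoiding the roots of [r1 r2 P] gives a point of the curve outside both sets. *)
Lemma geom_irreducible_curve (F : fieldType) k (c b a e : F) :
  c != 0 -> e != 0 -> geom_irreducible (curve k c b a e).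
Proof.
move=> c0 e0 L s _; rewrite map_curve.
have {c0} : s c != 0 by rewrite fmorph_eq0.
have {e0} : s e != 0 by rewrite fmorph_eq0.
move: (s c) (s b) (s a) (s e) => {c b a e}c b a e e0 c0.
have onC t : (curveP k c b a e).[t] != 0 ->
   exists v, [/\ mmap idfun v (curve k c b a e) = 0 & mmap idfun v (curveS k c b a e) = t].
  move=> P0; have P0' : (map_poly idfun (curveP k c b a e)).[t] != 0 by rewrite map_poly_id.
  by have [v0 _ vS] := eval_curve_pt c0 e0 P0'; exists (curve_pt k c b a e idfun t).
split.
  have /closed_nonrootP [t Pt] := curveP_neq0 k c b a e0.
  by have [v [v0 _]] := onC t Pt; exists v => p ->.
have not_zeroset (T : {mpoly L[2]} -> Prop) :
    ~ (forall v, zeroset (fun p => p = curve k c b a e) v -> zeroset T v) ->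
    exists v p, [/\ zeroset (fun p => p = curve k c b a e) v, T p & p.@[v] <> 0].
  move=> nT; apply: NNPP => nex; apply: nT => v Zv p Tp.
  by apply: NNPP => pv; apply: nex; exists v, p.
move=> S1 S2 S12; apply: NNPP => nS.
have [|v1 [p1 [Zv1 S1p1 p1v1]]] := not_zeroset S1; first by move=> ?; apply: nS; left.
have [|v2 [p2 [Zv2 S2p2 p2v2]]] := not_zeroset S2; first by move=> ?; apply: nS; right.
have [j1 [r1 nf1]] := eval_normal_form k b a c0 e0 idfun p1.
have [j2 [r2 nf2]] := eval_normal_form k b a c0 e0 idfun p2.
have r_neq0 (p : {mpoly L[2]}) j r v :
    (forall v, mmap idfun v (curve k c b a e) = 0 ->
      mmap idfun v p * (map_poly idfun (curveP k c b a e)).[mmap idfun v (curveS k c b a e)] ^+ j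
      = (map_poly idfun r).[mmap idfun v (curveS k c b a e)]) ->
    zeroset (fun p => p = curve k c b a e) v -> p.@[v] <> 0 -> r != 0.
  move=> nf Zv pv; apply/eqP => r0; apply: pv.
  have fv : mmap idfun v (curve k c b a e) = 0 by apply: Zv.
  have [Pv _] := curve_ptP c0 e0 fv.
  move: (nf v fv); rewrite r0 rmorph0 horner0 => /eqP.
  by rewrite mulf_eq0 expf_eq0 (negPf Pv) andbF orbF => /eqP.
have r10 := r_neq0 _ _ _ _ nf1 Zv1 p1v1.
have r20 := r_neq0 _ _ _ _ nf2 Zv2 p2v2.
have : r1 * r2 * curveP k c b a e != 0 by rewrite !mulf_neq0 // curveP_neq0.
move/closed_nonrootP => [t]; rewrite !rootM !negb_or => /andP[/andP[r1t r2t] Pt].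
have [v [v0 vS]] := onC t Pt.
have Zv : zeroset (fun p => p = curve k c b a e) v by move=> p ->.
move: (nf1 v v0) (nf2 v v0); rewrite vS !map_poly_id // => {}nf1 {}nf2.
case: (S12 v Zv) => [/(_ _ S1p1) p1v|/(_ _ S2p2) p2v].
  by move: r1t; rewrite rootE -nf1 -[mmap _ _ _]/(p1.@[v]) p1v mul0r eqxx.
by move: r2t; rewrite rootE -nf2 -[mmap _ _ _]/(p2.@[v]) p2v mul0r eqxx.
Qed.

(** * Isomorphism of the complements *)

Definition frac_const (F : fieldType) : {rmorphism F -> {fraction {mpoly F[2]}}} :=
  (@FracField.tofrac {mpoly F[2]}) \o (@mpolyC 2 F).

(* In the coordinates [x' = H/f], [y' = - y f^k] one has [H' = x/f] and
   [f' = 1/f], where [f'], [H'] come from the reciprocal polynomial of [P];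
   so the formulas for the inverse have the same shape. *)
Lemma compl_identities (R : fieldType) (k : nat) (c b a e x y h f : R) :
  c != 0 -> f != 0 -> e * h = x ^+ k.+1 * y - a * x + 1 ->
  f = c * x + b * h + y * h ^+ k.+1 ->
  ((h / f) ^+ k.+1 * - (y * f ^+ k) - b * (h / f) + 1) / c = x / f /\
  e * (h / f) + a * (x / f) + - (y * f ^+ k) * (x / f) ^+ k.+1 = f^-1.
Proof.
move=> c0 f0 eh fE.
have cx : c * x = f - b * h - y * h ^+ k.+1 by rewrite fE; ring.
have fk0 : f ^+ k != 0 by rewrite expf_neq0.
split; apply: (mulIf f0); rewrite !expr_div_n ![f ^+ k.+1]exprS.
  transitivity ((f - b * h - y * h ^+ k.+1) / c).
    by field; rewrite c0 f0 fk0.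
  by rewrite -cx; field; rewrite c0 f0.
transitivity (e * h + a * x - y * x ^+ k.+1).
  by field; rewrite f0 fk0.
by rewrite eh mulVf //; ring.
Qed.

Lemma compl_inverse_y (R : fieldType) (k : nat) (y f : R) : f != 0 ->
  - (- (y * f ^+ k) * f^-1 ^+ k.+1) * f = y.
Proof.
move=> f0; rewrite !mulNr opprK exprS exprVn.
by field; rewrite f0 expf_neq0.
Qed.

Section Complement.
Variables (F : fieldType) (k : nat).
Local Notation P := {mpoly F[2]}.
Local Notation "x %:F" := (@FracField.tofrac P x).
Local Notation X := ('X_ord0 : P).
Local Notation Y := ('X_ord_max : P).

(** Numerators of [(H / f, - y f^k)] over the common denominator [f], whence the exponent [k.+1] in
    the second one. *)
Definition compl_map (c b a e : F) (i : 'I_2) : P :=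
  if i == ord0 then curveH k a e else - (Y * curve k c b a e ^+ k.+1).

Lemma tofrac_mmap (p : P) : p%:F = mmap (frac_const F) (fun i => ('X_i)%:F) p.
Proof. by rewrite -[p in LHS]mmap_id; apply: (rmorph_mmap (@FracField.tofrac P)). Qed.

(** One of the two composites. Reversing the coefficients is an involution, so the other composite
    is the same statement with [(e, a, b, c)]. *)
Lemma compl_iso_half (c b a e : F) : c != 0 -> e != 0 ->
  let f := curve k c b a e in
  let v := fun i => (compl_map c b a e i)%:F / f%:F ^+ 1 in
  [/\ evK v (curve k e a b c) = f%:F^-1,
      unit_loc f (evK v (curve k e a b c)) &
      forall i, evK v (compl_map e a b c i) / evK v (curve k e a b c) ^+ 1
                = ('X_i : P)%:F].
Proof.
move=> c0 e0 f v; set g := curve k e a b c.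
have f0 : f%:F != 0 by rewrite tofrac_eq0 curve_neq0.
have hc : frac_const F c != 0 by rewrite fmorph_eq0.
have he : frac_const F e != 0 by rewrite fmorph_eq0.
have vX : v ord0 = (curveH k a e)%:F / f%:F by rewrite /v expr1.
have vY : v ord_max = - (Y%:F * f%:F ^+ k).
  rewrite /v expr1 /compl_map /= tofracN tofracM tofracXn exprSr.
  by rewrite mulNr mulrA (mulfK f0).
have fE : f%:F = frac_const F c * X%:F + frac_const F b * (curveH k a e)%:F
            + Y%:F * (curveH k a e)%:F ^+ k.+1.
  by rewrite (tofrac_mmap f) mmap_curve -tofrac_mmap.
have hE : frac_const F e * (curveH k a e)%:F =
    X%:F ^+ k.+1 * Y%:F - frac_const F a * X%:F + 1.
  by rewrite (tofrac_mmap (curveH _ _ _)) mmap_curveH mulrC (divfK he).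
have [id1 id2] := compl_identities hc f0 hE fE.
have H' : mmap (frac_const F) v (curveH k b c) = X%:F / f%:F.
  by rewrite mmap_curveH vX vY id1.
have g' : evK v g = f%:F^-1.
  have -> : evK v g = mmap (frac_const F) v g by [].
  by rewrite mmap_curve H' vX vY id2.
split; first exact: g'.
  rewrite g'; split; first by rewrite invr_eq0 f0.
  split; first by exists 1, 1%N; rewrite tofrac1 expr1 mul1r.
  by exists f, 0%N; rewrite expr0 divr1 invrK.
move=> i; rewrite g' expr1 invrK; case: (ord2_cases i) => ->.
  have -> : evK v (compl_map e a b c ord0) = mmap (frac_const F) v (curveH k b c) by [].
  by rewrite H' (divfK f0).
have -> : evK v (compl_map e a b c ord_max) = - (v ord_max * (evK v g) ^+ k.+1).
  transitivity (mmap (frac_const F) v (- (Y * g ^+ k.+1))); first by [].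
  by rewrite rmorphN rmorphM rmorphXn /= mmap_X.
rewrite g' vY; exact: compl_inverse_y f0.
Qed.

Lemma compl_iso_curve (c b a e : F) : c != 0 -> e != 0 ->
  compl_iso (curve k c b a e) (curve k e a b c).
Proof.
move=> c0 e0; exists (compl_map e a b c), (compl_map c b a e), 1%N, 1%N.
have [_ u1 u2] := compl_iso_half a b e0 c0.
by have [_ v1 v2] := compl_iso_half b a c0 e0.
Qed.
End Complement.

(** * Isomorphisms of the curves *)

(** The combination [al (ga T + de) - ga (al T + be)] is the determinant, a nonzero constant. *)
Lemma coprimep_linear (F : fieldType) (al be ga de : F) :
  al * de - be * ga != 0 -> coprimep (ga *: 'X + de%:P) (al *: 'X + be%:P).
Proof.
move=> det0; apply/Bezout_eq1_coprimepP.
exists ((al / (al * de - be * ga))%:P, (- ga / (al * de - be * ga))%:P) => /=.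
rewrite -!mul_polyC !mulrDr !mulrA -!polyCM addrACA -mulrDl -!polyCD.
have -> : al / (al * de - be * ga) * ga + - ga / (al * de - be * ga) * al = 0.
  by field.
rewrite polyC0 mul0r add0r -polyC1; congr (_%:P); field; exact: det0.
Qed.

Lemma eq_mmap (F : fieldType) (R : comNzRingType) (h : F -> R) (v w : 'I_2 -> R)
    (p : {mpoly F[2]}) : v =1 w -> mmap h v p = mmap h w p.
Proof.
by move=> vw; apply: eq_bigr => m _; rewrite (mmap1_eq m vw).
Qed.

Lemma mmap_evP (F : fieldType) (R : comNzRingType) (h : {rmorphism F -> R})
    (v : 'I_2 -> R) (phi : 'I_2 -> {mpoly F[2]}) (p : {mpoly F[2]}) :
  mmap h v (evP phi p) = mmap h (fun i => mmap h v (phi i)) p.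
Proof.
rewrite /evP (rmorph_mmap (mmap h v)); apply: eq_bigr => m _ /=.
by rewrite mmapC.
Qed.

(** The parameter of the second curve becomes a function [s] in [F[T, 1/P]], and the inverse
    isomorphism expresses [T] rationally in [s]; so [s = U / V] has degree one. Both [s] and
    [1 / Q(s)] have poles only at roots of [P], which gives the divisibility: the roots of [V] are
    sent to infinity, those of the other factor to roots of [Q]. *)
Lemma curve_iso_moebius (F : fieldType) (k : nat) (c b a e c' b' a' e' : F) :
  c != 0 -> e != 0 -> c' != 0 -> e' != 0 ->
  curve_iso (curve k c b a e) (curve k c' b' a' e') ->
  exists al be ga de : F, al * de - be * ga != 0 /\
    exists j, let U := al *: 'X + be%:P in let V := ga *: 'X + de%:P in
      V * homogenize k.+2 (fun i => ((curveP k c' b' a' e')`_i)%:P) U V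
        %| curveP k c b a e ^+ j.
Proof.
move=> c0 e0 c0' e0' [phi [psi [fg _ fX _]]].
set P := curveP k c b a e; set Q := curveP k c' b' a' e'.
pose ev (u : 'I_2 -> {fraction {poly F}}) p := mmap (rat_const F) u p.
set t := FracField.tofrac 'X : {fraction {poly F}}.
have P0 : (map_poly (rat_const F) P).[t] != 0.
  by rewrite horner_rat_const tofrac_eq0 curveP_neq0.
have [f0 _ vS] := eval_curve_pt c0 e0 P0.
set v := curve_pt _ _ _ _ _ _ _ in f0 vS.
(* The image of the generic point of the first curve, a point of the second curve over [F(T)]; [s]
   below is its parameter. *)
pose w i := ev v (phi i).
have evw p : ev v (evP phi p) = ev w p by rewrite /ev mmap_evP.
have g0 : ev w (curve k c' b' a' e') = 0.
  by rewrite -evw; apply: mdvd_eq0 fg f0.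
have [Q0 wH] := curve_ptP c0' e0' g0.
set s := mmap _ w _ in Q0 wH.
have nf p : exists j r, ev w p * FracField.tofrac (P ^+ j) = FracField.tofrac r.
  have [j [r nf]] := eval_normal_form k b a c0 e0 (rat_const F) (evP phi p).
  exists j, r; have := nf v f0; rewrite vS !horner_rat_const => <-.
  by rewrite tofracXn -evw.
have [j1 [r1 nf1]] := nf (curveS k c' b' a' e').
have [j2 [r2 nf2]] := nf (curveH k a' e').
have [j3 [r3 nf3]] :=
  eval_normal_form k b' a' c0' e0' (rat_const F) (evP psi (curveS k c b a e)).
have tE : ev w (evP psi (curveS k c b a e)) = t.
  rewrite /ev mmap_evP -vS; apply: eq_mmap => i.
  transitivity (ev v (evP phi (psi i))); first by rewrite evw.
  by rewrite /ev (mdvd_eval (fX i) f0) mmap_X.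
have := nf3 w g0; rewrite -/(ev _ _) tE -horner_exp -rmorphXn => Xs.
have Q0' : (map_poly (rat_const F) (Q ^+ j3)).[s] != 0.
  by rewrite rmorphXn horner_exp (expf_neq0 _ Q0).
have Pj0 : P ^+ j1 != 0 by rewrite expf_neq0 // curveP_neq0.
have sE : s = FracField.tofrac r1 / FracField.tofrac (P ^+ j1).
  have PK0 : FracField.tofrac (P ^+ j1) != 0 by rewrite tofrac_eq0.
  by rewrite -nf1 (mulfK PK0).
have [al [be [ga [de [det0 sUV]]]]] := moebius Pj0 sE Q0' Xs.
exists al, be, ga, de; split=> //.
set U := al *: 'X + _ in sUV *; set V := ga *: 'X + _ in sUV *.
have V0 : V != 0.
  apply: contra_neq det0 => V0.
  have := congr1 (fun p : {poly F} => p`_0) V0; have := congr1 (fun p : {poly F} => p`_1) V0.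
  by rewrite !coefE /= !(mulr0, mulr1, add0r, addr0) => -> ->; rewrite !mulr0 subrr.
(* Compare the two expressions of [s], [U / V] in lowest terms and [r1 / P^j1]. *)
have VP : V %| P ^+ j1.
  have cVU : coprimep V U := coprimep_linear det0.
  rewrite -(Gauss_dvdpr _ cVU).
  have -> : U * P ^+ j1 = r1 * V.
    have VK0 : FracField.tofrac V != 0 by rewrite tofrac_eq0.
    apply: tofrac_inj; rewrite !tofracM -nf1 -[ev w _]/s sUV.
    by rewrite [RHS]mulrAC (divfK VK0).
  by rewrite dvdp_mull.
pose N := homogenize k.+2 (fun i => (Q`_i)%:P) U V.
have sQ : (size Q <= k.+3)%N.
  rewrite /Q /curveP; do 3?[apply: leq_trans (size_polyD _ _) _; rewrite geq_max; apply/andP; split].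
  - by apply: leq_trans (size_scale_leq _ _) _; rewrite size_polyXn.
  - by apply: leq_trans (size_scale_leq _ _) _; rewrite size_polyXn.
  - by apply: leq_trans (size_scale_leq _ _) _; rewrite size_polyX.
  - by apply: leq_trans (size_polyC_leq1 _) _.
have NE := tofrac_homog sQ V0 sUV.
(* Here [N = V^(k+2) Q(s)], while [1 / Q(s)] is the value of [H] at [w], equal to [r2 / P^j2]. *)
have NP : N %| V ^+ k.+2 * P ^+ j2.
  have -> : V ^+ k.+2 * P ^+ j2 = r2 * N; last by rewrite dvdp_mull.
  apply: tofrac_inj; rewrite [LHS]tofracM tofracXn [RHS]tofracM -nf2 NE /ev wH.
  by rewrite [RHS]mulrC mulrA (mulfK Q0).
exists (j1 + (j1 * k.+2 + j2))%N.
change (V * N %| P ^+ (j1 + (j1 * k.+2 + j2))).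
rewrite 2!exprD dvdp_mul // (dvdp_trans NP) // dvdp_mul // exprM.
by apply: dvdp_exp2r.
Qed.

(** By separability the cofactor of [gcdp p q] in [p] is coprime to [q]; dividing a power of [q], it
    is constant. *)
Lemma separable_dvdp_exp (F : fieldType) (p q : {poly F}) j :
  separable_poly p -> p %| q ^+ j -> p %| q.
Proof.
move=> sep_p p_qj; have p0 := separable_poly_neq0 sep_p.
pose d := gcdp p q; have pE : p %/ d * d = p by rewrite divpK // dvdp_gcdl.
have cd : coprimep (p %/ d) d.
  by apply: (separable_coprime sep_p); rewrite pE dvdpp.
have cq : coprimep (p %/ d) q.
  apply/coprimepP => r rp rq; have /coprimepP := cd; apply=> //.
  by rewrite dvdp_gcd rq andbT -pE dvdp_mulr.
have : size (p %/ d) == 1%N.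
  rewrite -coprimepp; apply: coprimep_dvdl (coprimep_expr j cq).
  by apply: dvdp_trans p_qj; rewrite -{2}pE dvdp_mulr.
move=> /eqP sz; have : p %| d.
  rewrite -{1}pE; have /size_poly1P [u u0 ->] : size (p %/ d) == 1%N by rewrite sz.
  by rewrite mul_polyC dvdpZl ?dvdpp.
by move=> /dvdp_trans; apply; apply: dvdp_gcdr.
Qed.

(** * Cubics: separability and the invariant of binary quartics *)

Section Cubic.
Variables (F : fieldType) (b a e al be ga de : F).
Hypothesis det0 : al * de - be * ga != 0.
(** The invariant of the roots together with infinity vanishes; the next hypothesis then says that
    the cubic is separable, with characteristic 3 as its second case. *)
Hypothesis ba : b ^+ 2 = 3%:R * a.
Hypothesis disc : 9%:R * e - a * b != 0 \/ [/\ 3%:R = 0 :> F, b = 0 & a != 0].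

Local Notation U := (al *: 'X + be%:P).
Local Notation V := (ga *: 'X + de%:P).

(* The cubic form dehomogenizing to [T^3 + b T^2 + a T + e], and its partial
   derivative in the first variable. *)
Let G (R : comNzRingType) (h : F -> R) (u v : R) :=
  u * u * u + h b * (u * u * v) + h a * (u * v * v) + h e * (v * v * v).
Let Gu (R : comNzRingType) (h : F -> R) (u v : R) :=
  (u * u) *+ 3 + (h b * u * v) *+ 2 + h a * (v * v).

Local Notation N := (G (@polyC F) U V).

(** Elimination of [u]: the remainder of [9 G] modulo [Gu] is [(9 e - a b) v^3] because [b^2 = 3 a];
    in characteristic 3 with [b = 0], [Gu] is already [a v^2]. *)
Lemma cubic_elim (R : comNzRingType) (h : {rmorphism F -> R}) :
  exists2 kap : F, kap != 0 & forall u v : R, exists q1 q2,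
    h kap * v ^+ 3 = q1 * G h u v + q2 * Gu h u v.
Proof.
case: disc => [nz|[c3 b0 a0]].
  exists (9%:R * e - a * b) => // u v.
  exists 9%:R, (- (3%:R * u + h b * v)).
  have hba : h b ^+ 2 = 3%:R * h a by rewrite -rmorphXn ba rmorphM rmorph_nat.
  rewrite rmorphB !rmorphM rmorph_nat /G /Gu.
  transitivity ((9%:R * h e - h a * h b) * v ^+ 3 +
                2%:R * (3%:R * h a - h b ^+ 2) * u * v ^+ 2).
    by rewrite hba; ring.
  by ring.
exists a => // u v; exists 0, v; rewrite mul0r add0r /Gu b0 rmorph0.
have c3R : 3%:R = 0 :> R by rewrite -(rmorph_nat h) c3 rmorph0.
by rewrite -[u * u *+ 3]mulr_natr c3R; ring.
Qed.

Lemma separable_quartic : separable_poly (V * N).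
Proof.
have cVN : coprimep V N.
  have -> : N = (b%:P * (U * U) + a%:P * (U * V) + e%:P * (V * V)) * V + U ^+ 3.
    by rewrite /G; ring.
  by rewrite coprimep_addl_mul coprimep_expr // (coprimep_linear det0).
rewrite separable_mul cVN andbT; apply/andP; split.
  rewrite unlock derivD derivZ derivX derivC addr0 alg_polyC.
  have [ga0|ga0] := eqVneq ga 0.
    have de0 : de != 0.
      by apply: contraNneq det0 => ->; rewrite ga0 !mulr0 subr0.
    by rewrite ga0 scale0r add0r polyC0 coprimep0 -size_poly_eq1 size_polyC de0.
  by rewrite coprimep_sym; apply/Bezout_eq1_coprimepP; exists (ga^-1%:P, 0) => /=; rewrite mul0r addr0 -polyCM mulVf.
rewrite unlock; apply/coprimepP => d dN dN'.
have dU : U^`() = al%:P by rewrite derivD derivZ derivX derivC addr0 alg_polyC.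
have dV : V^`() = ga%:P by rewrite derivD derivZ derivX derivC addr0 alg_polyC.
have dGu : d %| Gu (@polyC F) U V.
  rewrite -(dvdpZr _ _ det0).
  (* Combine the chain rule for [G(p, q)] with Euler's relation [3 G = u Gu + v Gv]. For [p = U],
     [q = V] the Wronskian is the determinant. *)
  have euler (p q : {poly F}) : (p^`() * q - p * q^`()) * Gu (@polyC F) p q =
      q * (G (@polyC F) p q)^`() - (3%:R * q^`()) * G (@polyC F) p q.
    by rewrite /G !(derivD, derivM, derivC) /Gu; ring.
  have -> : (al * de - be * ga) *: Gu (@polyC F) U V =
      V * N^`() - (3%:R * V^`()) * N.
    rewrite -euler dU dV -!mul_polyC polyCB !polyCM; congr (_ * _); ring.
  by rewrite dvdp_sub ?dvdp_mull.
have [kap kap0 elim] := cubic_elim (@polyC F).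
have [q1 [q2 E]] := elim U V.
have dV3 : d %| V ^+ 3.
  by rewrite -(dvdpZr _ _ kap0) -mul_polyC E dvdp_add ?dvdp_mull.
by have /coprimepP := coprimep_expl 3 cVN; apply.
Qed.

(** By separability [V N] divides [P] itself. As quartics with one root at infinity both have degree
    exactly 3, so they are proportional; but the invariant vanishes on [V N] and equals
    [a^2 - 3 e b] on [P]. *)
Lemma quartic_nonproportional (P : {poly F}) j : P = e *: 'X^3 + a *: 'X^2 + b *: 'X + 1%:P ->
  e != 0 -> a ^+ 2 != 3%:R * e * b -> ~ V * N %| P ^+ j.
Proof.
move=> PE e0 I0 /(separable_dvdp_exp separable_quartic) WP.
(* The coefficients of [N], by decreasing degree. *)
pose n3 := G id al ga.
pose n2 := be * Gu id al ga + de * (b * (al * al) + (a * (al * ga)) *+ 2 + (e * (ga * ga)) *+ 3).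
pose n1 := (al * be * be) *+ 3 + b * (be * be * ga + (al * be * de) *+ 2)
   + a * (al * de * de + (be * ga * de) *+ 2) + (e * ga * de * de) *+ 3.
pose n0 := G id be de.
have WE : V * N = (ga * n3) *: 'X^4 + (ga * n2 + de * n3) *: 'X^3
   + (ga * n1 + de * n2) *: 'X^2 + (ga * n0 + de * n1) *: 'X + (de * n0)%:P.
  rewrite /n3 /n2 /n1 /n0 /G /Gu -!mul_polyC !(polyCM, polyCD, polyCMn); ring.
set W := V * N in WP WE.
have Wc i : W`_i = nth 0 [:: de * n0; ga * n0 + de * n1; ga * n1 + de * n2;
    ga * n2 + de * n3; ga * n3] i.
  rewrite WE !coefE; case: i => [|[|[|[|[|i]]]]] /=; rewrite ?nth_nil; ring.
have Pc i : P`_i = nth 0 [:: 1; b; a; e] i.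
  rewrite PE !coefE; case: i => [|[|[|[|i]]]] /=; rewrite ?nth_nil; ring.
have sP : size P = 4%N.
  apply/eqP; rewrite eqn_leq; apply/andP; split.
    by apply/leq_sizeP => i i4; rewrite Pc nth_default.
  by rewrite ltnNge; apply/negP => /leq_sizeP/(_ 3%N isT)/eqP; rewrite Pc /= (negPf e0).
have P0 : P != 0 by rewrite -size_poly_eq0 sP.
have sW : (size W <= 4)%N by rewrite -sP dvdp_leq.
have w4 : ga * n3 = 0 by have := Wc 4%N; rewrite nth_default //= => <-.
(* Otherwise infinity would be a double root of the quartic form; [cubic_elim] at the point
   [(al, ga)] excludes this. *)
have w3 : ga * n2 + de * n3 != 0.
  apply/eqP => w3; have [ga0|ga0] := eqVneq ga 0.
    move: w3; rewrite ga0 mul0r add0r /n3 /G ga0 => /eqP.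
    rewrite !(mulr0, addr0) !mulf_eq0 => H; move: det0; rewrite ga0 mulr0 subr0 mulf_eq0.
    by case/orP: H => [->|/orP[/orP[]|] ->]; rewrite ?orbT.
  have n30 : n3 = 0 by apply: (mulfI ga0); rewrite w4 mulr0.
  have n20 : n2 = 0 by apply: (mulfI ga0); rewrite mulr0 -w3 n30 mulr0 addr0.
  have Gu0 : Gu id al ga = 0.
    apply: (mulfI det0); rewrite mulr0.
    transitivity (3%:R * de * n3 - ga * n2); last by rewrite n30 n20; ring.
    by rewrite /n3 /n2 /G /Gu; ring.
  have [kap kap0 elim] := cubic_elim idfun.
  have [q1 [q2]] := elim al ga.
  rewrite -[G idfun al ga]/n3 n30 -[Gu idfun al ga]/(Gu id al ga) Gu0 !mulr0 addr0 /= => /eqP.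
  by rewrite mulf_eq0 (negPf kap0) expf_eq0 (negPf ga0).
have sW4 : size W = 4%N.
  apply/eqP; rewrite eqn_leq sW ltnNge; apply/negP => /leq_sizeP/(_ 3%N isT)/eqP.
  by rewrite Wc /= (negPf w3).
have := dvdp_size_eqp WP; rewrite sW4 sP eqxx => /esym/eqpP [[x y] /= /andP[x0 y0] xy].
have cxy i : x * W`_i = y * P`_i by rewrite -!coefZ xy.
have c0 := cxy 0%N; have c1 := cxy 1%N; have c2 := cxy 2%N; have c3 := cxy 3%N.
move: c0 c1 c2 c3; rewrite !Wc !Pc /= => c0 c1 c2 c3.
move/negP: I0; apply; rewrite -subr_eq0; apply/eqP/(mulfI (expf_neq0 2 y0)).
rewrite mulr0.
transitivity ((y * a) ^+ 2 - 3%:R * (y * e) * (y * b)); first by ring.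
rewrite -c1 -c2 -c3.
(* [12 w4 w0 - 3 w3 w1 + w2^2] is the degree-two invariant of binary quartics:
   on [V N] it is [det^4] times its value [b^2 - 3 a] on [v G(u, v)]. *)
transitivity (x ^+ 2 * ((al * de - be * ga) ^+ 4 * (b ^+ 2 - 3%:R * a)
   - 12%:R * (ga * n3) * (de * n0))); last by rewrite ba w4; ring.
by rewrite /n3 /n2 /n1 /n0 /G /Gu; ring.
Qed.
End Cubic.

(** * Quartics over the field with two elements *)

Section TwoElements.
Variables (F : fieldType) (F2 : two_elements F).

Lemma two_eq0 : 2%:R = 0 :> F.
Proof.
by case: (F2 2%:R) => // /eqP; rewrite -subr_eq0 (_ : 2%:R - 1 = 1) ?oner_eq0 //; ring.
Qed.

(** [P] takes the value 1 at both elements, so [V] has no root and the substitution is a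
    translation. Both translations fix [T^4 + T + 1], which is coprime to [P]. *)
Lemma quartic_no_iso (al be ga de : F) j : al * de - be * ga != 0 ->
  ~ (ga *: 'X + de%:P) * homogenize 4 (fun i => ((curveP 2 1 0 1 1)`_i)%:P)
        (al *: 'X + be%:P) (ga *: 'X + de%:P) %| curveP 2 1 1 0 1 ^+ j.
Proof.
set P := curveP 2 1 1 0 1 => det0.
have c2 : 2%:R = 0 :> {poly F} by rewrite -(rmorph_nat (@polyC F)) two_eq0.
have PE : P = 'X^4 + 'X^3 + 1 by rewrite /P /curveP !scale1r scale0r addr0.
have Pr x : P.[x] = 1.
  rewrite PE !hornerE; case: (F2 x) => ->; first by rewrite !expr0n /= !add0r.
  by rewrite !expr1n -[1 + 1]/(2%:R) two_eq0 add0r.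
move=> VN_P; have V_P := dvdp_trans (dvdp_mulIl _ _) VN_P.
have ga0 : ga = 0.
  apply/eqP; apply/negP => /negP ga0.
  have Vr : root (ga *: 'X + de%:P) (- de / ga).
    by rewrite rootE hornerD hornerZ hornerX hornerC mulrC divfK // addNr.
  move: V_P; rewrite dvdp_eq => /eqP E.
  have := congr1 (fun p : {poly F} => p.[- de / ga]) E.
  rewrite horner_exp Pr expr1n hornerM (rootP Vr) mulr0 => /eqP.
  by rewrite oner_eq0.
move: det0 VN_P; rewrite ga0 mulr0 subr0 mulf_eq0 negb_or => /andP[al0 de0].
have -> : al = 1 by case: (F2 al) => // E; rewrite E eqxx in al0.
have -> : de = 1 by case: (F2 de) => // E; rewrite E eqxx in de0.
rewrite scale0r add0r mul1r.
set N := homogenize _ _ _ _ => NP.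
have NE : N = 'X^4 + 'X + 1.
  rewrite /N /homogenize !big_ord_recr big_ord0 /curveP !coefE /= !expr1n scale1r.
  rewrite !(mulr0, mulr1, mul0r, add0r, addr0) polyC1.
  case: (F2 be) => ->; first by rewrite polyC0; ring.
  rewrite polyC1.
  transitivity ('X^4 + 'X + 1 + 2%:R * ('X^3 *+ 2 + 'X^2 *+ 3 + 'X *+ 2) + 2%:R : {poly F}).
    by ring.
  by rewrite c2; ring.
have cNP : coprimep N P.
  (* Bezout coefficients modulo 2; over the integers the combination is 1 plus an even
     polynomial. *)
  apply/Bezout_eq1_coprimepP; exists (1 + 'X + 'X^3, 'X^3 + 'X^2) => /=.
  rewrite NE PE; transitivity
    (1 + 2%:R * ('X^7 + 'X^6 + 'X^5 + 'X^4 + 'X^3 + 'X^2 + 'X) : {poly F}).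
    by ring.
  by rewrite c2; ring.
have : size N == 1%N.
  by rewrite -coprimepp; apply: coprimep_dvdl NP _; apply: coprimep_expr.
move/eqP => sN; have := congr1 (fun p : {poly F} => p`_4) NE.
by rewrite nth_default ?sN // !coefE /= !addr0 => /eqP; rewrite eq_sym oner_eq0.
Qed.
End TwoElements.

(** * Choice of the coefficients *)

Lemma curve_pair (F : fieldType) k (c b a e : F) : c != 0 -> e != 0 ->
  ~ curve_iso (curve k c b a e) (curve k e a b c) ->
  exists f g : {mpoly F[2]},
    [/\ irreducible_elt f /\ irreducible_elt g,
        geom_irreducible f /\ geom_irreducible g,
        ~ curve_iso f g, compl_iso f g &
        tdeg f = (k.+1 * k.+2).+1 /\ tdeg g = (k.+1 * k.+2).+1].
Proof.
move=> c0 e0 nfg; exists (curve k c b a e), (curve k e a b c); split=> //.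
- by split; apply: irreducible_curve.
- by split; apply: geom_irreducible_curve.
- exact: compl_iso_curve.
- by split; apply: tdeg_curve.
Qed.

Lemma cubic_no_iso (F : fieldType) (b a e : F) : e != 0 -> b ^+ 2 = 3%:R * a ->
  9%:R * e - a * b != 0 \/ [/\ 3%:R = 0 :> F, b = 0 & a != 0] ->
  a ^+ 2 != 3%:R * e * b -> ~ curve_iso (curve 1 e a b 1) (curve 1 1 b a e).
Proof.
move=> e0 ba disc I0 iso.
have [al [be [ga [de [det0 [j]]]]]] :=
  curve_iso_moebius e0 (oner_neq0 F) (oner_neq0 F) e0 iso.
cbv zeta; set U := al *: 'X + _; set V := ga *: 'X + _.
have -> : homogenize 3 (fun i => ((curveP 1 1 b a e)`_i)%:P) U V =
    U * U * U + b%:P * (U * U * V) + a%:P * (U * V * V) + e%:P * (V * V * V).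
  rewrite /homogenize !big_ord_recr big_ord0 /curveP !coefE /=.
  move: U V => U V.
  by rewrite !(mulr0, mulr1, add0r, addr0) polyC1; ring.
by apply: (quartic_nonproportional det0 ba disc _ e0 I0); rewrite /curveP.
Qed.

Theorem theorem3 (F : fieldType) :
  exists f g : {mpoly F[2]},
    [/\ irreducible_elt f /\ irreducible_elt g,
        geom_irreducible f /\ geom_irreducible g,
        ~ curve_iso f g,
        compl_iso f g &
        (two_elements F -> tdeg f = 13%N /\ tdeg g = 13%N) /\
        (~ two_elements F -> tdeg f = 7%N /\ tdeg g = 7%N)].
Proof.
have n1 := oner_neq0 F.
case: (classic (two_elements F)) => F2.
  have [iso|f [g [irr girr nfg cfg deg]]] := curve_pair (k := 2) (b := 1) (a := 0) n1 n1.
    have [al [be [ga [de [det0 [j /= VN]]]]]] := curve_iso_moebius n1 n1 n1 n1 iso.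
    exact: quartic_no_iso det0 VN.
  by exists f, g; split.
suff [c [b [a [c0 nfg]]]] : exists c b a : F,
    c != 0 /\ ~ curve_iso (curve 1 c b a 1) (curve 1 1 a b c).
  have [f [g [irr girr nfg' cfg deg]]] := curve_pair c0 n1 nfg.
  by exists f, g; split.
have [c3|c3] := eqVneq (3%:R : F) 0.
  (* Characteristic 3: the cubics [T^3 + T^2 + 1] and [T^3 + T + 1], the invariant vanishing for the
     second only. *)
  exists 1, 1, 0; split=> //; apply: cubic_no_iso => //.
  - by rewrite c3 expr0n mul0r.
  - by right.
  - by rewrite c3 !mul0r expr1n.
have [z zP] := not_all_ex_not _ _ F2.
have z0 : z != 0 by apply/eqP => E; apply: zP; left.
have z1 : z - 1 != 0 by rewrite subr_eq0; apply/eqP => E; apply: zP; right.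
have c9 : 9%:R * (z - 1) != 0 by rewrite (natrM F 3 3) !mulf_neq0.
(* The second cubic is [(T + 1)^3 + z - 1], of invariant 0. Its separability and the nonvanishing of
   the other invariant [9 (1 - z)] both follow from [z != 1]. *)
exists z, 3%:R, 3%:R; split=> //; apply: cubic_no_iso => //.
- by left; rewrite (_ : _ - _ = 9%:R * (z - 1)) //; ring.
- by rewrite -subr_eq0 -oppr_eq0 (_ : - _ = 9%:R * (z - 1)) //; ring.
Qed.
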